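(* Let $S,T:\mathbb{F}_q^n\to\mathbb{F}_q^n$ be nilpotent $\mathbb{F}_q$-linear maps. Then $T\sim S$ if and only if the sequences of Jordan block lengths in the Jordan canonical forms of $S$ and $T$ coincide up to a permutation. In particular, if $P(k)$ is the number of partitions of the integer $k$ and $B_q(k)$ is the number of pairwise non-isomorphic functional graphs $G(T/\mathbb{F}_q^k)$ arising from bijective $\mathbb{F}_q$-linear maps $T:\mathbb{F}_q^k\to\mathbb{F}_q^k$, then $$A_q(n)=\sum_{k=0}^n P(k)\,B_q(n-k),$$ where $A_q(n)$ is the number of pairwise non-isomorphic functional graphs arising from all $\mathbb{F}_q$-linear maps $\mathbb{F}_q^n\to\mathbb{F}_q^n$.
   Context: For finite sets $X,Y$, maps $S:X\to X$ and $T:Y\to Y$ are dynamically equivalent, written $T\sim S$, if there is a bijection $f:X\to Y$ with $S=f^{-1}\circ T\circ f$. For a linear map $T$ on $\mathbb{F}_q^k$, the functional graph $G(T/\mathbb{F}_q^k)$ is the directed graph with vertex set $\mathbb{F}_q^k$ and edges $v\to T(v)$. Conventionally $P(0)=B_q(0)=1$ (the zero-dimensional space contributes one graph). *)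

(* Defs.v *)
From HB Require Import structures.
From mathcomp Require Import all_boot all_order all_fingroup all_algebra.

Set Implicit Arguments.
Unset Strict Implicit.
Unset Printing Implicit Defensive.

Import GRing.Theory.
Local Open Scope ring_scope.

(* T ~ S, written with an explicit inverse g of the bijection f : X -> Y. *)
Definition dyn_equiv (X Y : finType) (T : Y -> Y) (S : X -> X) : Prop :=
  exists (f : X -> Y) (g : Y -> X),
    [/\ cancel f g, cancel g f & S =1 g \o T \o f].

Definition nilpotent_map (V : nmodType) (T : V -> V) : Prop :=
  exists k : nat, forall v, iter k T v = 0.

(* MathComp's convention is that matrices act on row vectors from the right:   *)
(* row i of a matrix lists the coordinates of the image of the i-th basis      *)
(* vector, so the off-diagonal 1s say T e_i = a *: e_i + e_(i+1).              *)
Definition jordan_block (F : fieldType) (a : F) (m : nat) : 'M[F]_m :=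
  \matrix_(i < m, j < m) (a *+ (i == j) + (i.+1 == j :> nat)%:R).

(* A block structure is a sequence of pairs (eigenvalue, length). *)
Definition jordan_mx (F : fieldType) (b : seq (F * nat)) :=
  \mxdiag_(i < size b) jordan_block (nth (0, 0%N) b i).1 (nth (0, 0%N) b i).2.

(* The rows of P are the vectors of a Jordan basis for T; row_free and         *)
(* row_full together say that they form a basis, and force the lengths to sum  *)
(* to n (so no cast between 'M_(\sum_i _) and 'M_n is needed). The eigenvalues *)
(* are required to lie in F, as is the case for a nilpotent T.                 *)
Definition jordan_form (F : fieldType) (n : nat)
    (T : {linear 'rV[F]_n -> 'rV[F]_n}) (b : seq (F * nat)) : Prop :=
  all (fun x => 0 < x.2)%N b /\
  exists P, [/\ row_free P, row_full P & P *m lin1_mx T = jordan_mx b *m P].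

Definition functional_graph (V : finType) (T : V -> V) : {set V * V} :=
  [set (v, T v) | v : V].

Definition digraph_iso (V : finType) (G H : {set V * V}) : bool :=
  [exists s : {perm V},
    [forall u, forall v, ((u, v) \in G) == ((s u, s v) \in H)]].

Definition num_iso_classes (V : finType) (D : {set {set V * V}}) : nat :=
  #|equivalence_partition (@digraph_iso V) D|.

Definition linear_maps (F : finFieldType) (n : nat) :
    {set {ffun 'rV[F]_n -> 'rV[F]_n}} :=
  [set T : {ffun 'rV[F]_n -> 'rV[F]_n} |
    [forall a : F, forall u, forall v,
      T (a *: u + v) == a *: T u + T v]].

Definition bijective_linear_maps (F : finFieldType) (n : nat) :
    {set {ffun 'rV[F]_n -> 'rV[F]_n}} :=
  [set T in linear_maps F n |
    injectiveb T && [forall w, exists v, T v == w]].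

Definition num_linear_graphs (F : finFieldType) (n : nat) : nat :=
  num_iso_classes
    [set functional_graph T | T : {ffun 'rV[F]_n -> 'rV[F]_n} in linear_maps F n].

Definition num_bijective_linear_graphs (F : finFieldType) (n : nat) : nat :=
  num_iso_classes
    [set functional_graph T
      | T : {ffun 'rV[F]_n -> 'rV[F]_n} in bijective_linear_maps F n].

(* A partition of k is a nonincreasing sequence of positive integers with sum  *)
(* k; it has at most k parts, all at most k, hence the finite ambient type.    *)
Definition num_partitions (k : nat) : nat :=
  #|[set s : k.-bseq 'I_k.+1 |
      [&& sorted geq (map val s), 0%N \notin map val s
        & sumn (map val s) == k]]|.

(* Main.v *)
(* A nilpotent map has a Jordan basis made of chains u, u A, ..., u A^(m-1), and
   the image of A^j then has dimension sum_i (m_i - j), truncated at 0.  The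
   cardinal of the image of T^j is invariant under dynamical equivalence, so
   these sums, hence the multiset of lengths m_i, are invariant; conversely equal
   lengths give even a linear conjugation.  A general A is, by Fitting's
   decomposition, equivalent to a product of a nilpotent J and a bijective B.
   The images of the powers of J x B determine dim B and the lengths of J, and
   their intersection 0 x F^m carries B, so the pair (lengths of J, class of B)
   is a complete invariant, and all pairs of the right dimension occur. *)
Require Import Defs.
From HB Require Import structures.
From mathcomp Require Import all_boot all_order all_fingroup all_algebra.
From mathcomp Require Import zify.
Import GRing.Theory.
Set Implicit Arguments.
Unset Strict Implicit.
Unset Printing Implicit Defensive.
Local Open Scope ring_scope.

(** * Jordan chains and Jordan bases of nilpotent matrices *)

Section JordanChains.

Variables (F : fieldType) (n : nat).
Implicit Types (A W : 'M[F]_n) (u : 'rV[F]_n) (s : seq ('rV[F]_n * nat)).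

Definition chain A u m : 'M[F]_(m, n) := \matrix_(i < m) (u *m A ^+ i).

Lemma chain_subP A u m p (W : 'M[F]_(p, n)) :
  reflect (forall i, (i < m)%N -> (u *m A ^+ i <= W)%MS) (chain A u m <= W)%MS.
Proof.
apply: (iffP row_subP) => [sub i im | sub i]; last by rewrite rowK sub.
by have := sub (Ordinal im); rewrite rowK.
Qed.

Lemma mulmx_exprS A p (B : 'M[F]_(p, n)) i : B *m A ^+ i.+1 = B *m A *m A ^+ i.
Proof. by rewrite exprS -mulmxE mulmxA. Qed.

Lemma mulmx_exprSr A p (B : 'M[F]_(p, n)) i : B *m A ^+ i.+1 = B *m A ^+ i *m A.
Proof. by rewrite exprSr -mulmxE mulmxA. Qed.

Lemma mulmx_exprD A p (B : 'M[F]_(p, n)) i j :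
  B *m A ^+ (i + j) = B *m A ^+ i *m A ^+ j.
Proof. by rewrite exprD -mulmxE mulmxA. Qed.

Lemma stable_expr A p (W : 'M[F]_(p, n)) i :
  (W *m A <= W)%MS -> (W *m A ^+ i <= W)%MS.
Proof.
move=> WA; elim: i => [|i IH]; first by rewrite expr0 mulmx1.
by rewrite mulmx_exprS (submx_trans (submxMr _ WA)).
Qed.

Lemma expr_eq0_le A p (B : 'M[F]_(p, n)) i j :
  (i <= j)%N -> B *m A ^+ i = 0 -> B *m A ^+ j = 0.
Proof. by move=> /subnKC <- B0; rewrite mulmx_exprD B0 mul0mx. Qed.

(** The rank equation stands for the independence of all the chain vectors; in particular no chain
    dies before its recorded length. [W] may be a proper subspace, as is needed for the kernel in
    Fitting's decomposition. *)
Definition chain_basis A W s : Prop :=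
  [/\ all (fun x => (0 < x.2)%N && (x.1 *m A ^+ x.2 == 0)) s,
      (W :=: \sum_(x <- s) <<chain A x.1 x.2>>)%MS
    & \rank W = (\sum_(x <- s) x.2)%N].

(* The splitting off of one longest chain: pairing the chain [u A^i] with the
   columns [A^(m-1-l) e_j] gives a triangular Gram matrix with nonzero diagonal
   [(u A^(m-1))_j], and the annihilator of these columns is stable under [A]. *)
Lemma split_chain A W k :
    (W *m A <= W)%MS -> W *m A ^+ k = 0 -> W != 0 ->
  exists u m W', [/\ (0 < m)%N, u *m A ^+ m = 0, (W' *m A <= W')%MS,
    (W :=: chain A u m + W')%MS & (\rank W = m + \rank W')%N] /\ (W' <= W)%MS.
Proof.
move=> WA Wk W0.
(* The longest chain has length [m], the least exponent that kills [W]; it starts at a row of [W]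
   that survives [A^(m-1)], with [j] a nonzero coordinate of the result. *)
have exk : exists k, W *m A ^+ k == 0 by exists k; apply/eqP.
case: (ex_minnP exk) => m /eqP Wm minm.
have m0 : (0 < m)%N.
  by rewrite lt0n; apply: contraNneq W0 => m0; rewrite -Wm m0 expr0 mulmx1.
have /matrix0Pn[i [j ij0]] : W *m A ^+ m.-1 != 0.
  by apply/negP => /minm; rewrite leqNgt prednK // leqnn.
pose u := row i W; pose C := \matrix_(a < n, l < m) (A ^+ (m.-1 - l)) a j.
have CE p (X : 'M_(p, n)) r l : (X *m C) r l = (X *m A ^+ (m.-1 - l)) r j.
  by rewrite !mxE; apply: eq_bigr => a _; rewrite mxE.
have uW : (u <= W)%MS by rewrite row_sub.
have um : u *m A ^+ m = 0 by rewrite -row_mul Wm row0.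
have unitG : chain A u m *m C \in unitmx.
  rewrite -unitmx_tr unitmxE det_trig.
    rewrite unitfE prodf_seq_neq0; apply/allP => l _ /=.
    rewrite mxE CE.
    have -> : (chain A u m *m A ^+ (m.-1 - l)) l j = (u *m A ^+ m.-1) 0 j.
      have -> : m.-1 = (l + (m.-1 - l))%N by have := ltn_ord l; lia.
      rewrite mulmx_exprD addKn -[u *m _](rowK (fun l : 'I_m => u *m A ^+ l) l).
      by rewrite -row_mul [RHS]mxE.
    by rewrite -row_mul mxE.
  apply/is_trig_mxP => l l' ll'; rewrite mxE CE.
  have -> : (chain A u m *m A ^+ (m.-1 - l)) l' j
          = (u *m A ^+ (l' + (m.-1 - l))) 0 j.
    rewrite mulmx_exprD -[u *m A ^+ l'](rowK (fun l : 'I_m => u *m A ^+ l) l').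
    by rewrite -row_mul [RHS]mxE.
  by rewrite (@expr_eq0_le _ _ _ m) ?mxE //; have := ltn_ord l; lia.
have rG : \rank (chain A u m *m C) = m by rewrite mxrank_unit.
have chW : (chain A u m <= W)%MS.
  by apply/chain_subP => a _; rewrite (submx_trans _ (stable_expr a WA)) ?submxMr.
pose W' := (W :&: kermx C)%MS.
have W'W : (W' <= W)%MS by rewrite capmxSl.
have W'C : W' *m C = 0 by apply/sub_kermxP; rewrite capmxSr.
have rWC : \rank (W *m C) = m.
  apply/eqP; rewrite eqn_leq rank_leq_col -{1}rG mxrankS //.
  by rewrite submxMr.
have rW : \rank W = (m + \rank W')%N by rewrite -(mxrank_mul_ker W C) rWC.
have rU : \rank (chain A u m) = m.
  by apply/eqP; rewrite eqn_leq rank_leq_row -{1}rG mxrankM_maxl.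
(* Multiplication by [C] preserves the rank of the chain, so the kernel of [C], which contains [W'],
   meets its span only in 0. *)
have cap0 : \rank (chain A u m :&: W') = 0%N.
  apply/eqP; rewrite -leqn0.
  have := mxrank_mul_ker (chain A u m) C; rewrite rG rU => /eqP.
  rewrite -[X in _ == X]addn0 eqn_add2l => /eqP <-.
  by rewrite mxrankS // capmxS // capmxSr.
exists u, m, W'; split=> //; split=> //.
  rewrite sub_capmx (submx_trans (submxMr _ W'W)) //=.
  (* Column [l] of [W' A C] is column [l.-1] of [W' C], which vanishes; for [l = 0] it vanishes
     because [A^m] kills [W']. *)
  apply/sub_kermxP/matrixP => r l; rewrite CE -mulmx_exprS [RHS]mxE.
  have [l0|l0] := posnP l.
    suff -> : W' *m A ^+ (m.-1 - l).+1 = 0 by rewrite mxE.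
    have -> : (m.-1 - l).+1 = m by lia.
    by apply/eqP; rewrite -submx0 -Wm submxMr.
  have lm : (l.-1 < m)%N by have := ltn_ord l; lia.
  have -> : (m.-1 - l).+1 = (m.-1 - Ordinal lm)%N by have := ltn_ord l => /=; lia.
  by rewrite -CE W'C mxE.
apply/eqmxP; rewrite andbC.
have sub : (chain A u m + W' <= W)%MS by rewrite addsmx_sub chW.
rewrite -(mxrank_leqif_eq sub).
by have := mxrank_sum_cap (chain A u m) W'; rewrite cap0 addn0 rU -rW => ->.
Qed.

Lemma chain_basis_exists A W k :
  (W *m A <= W)%MS -> W *m A ^+ k = 0 -> exists s, chain_basis A W s.
Proof.
have [r] := ubnP (\rank W); elim: r => // r IH in W *; rewrite ltnS => rW WA Wk.
have [->|W0] := eqVneq W 0.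
  by exists [::]; split; rewrite ?big_nil ?mxrank0.
have [u [m [W' [[m0 um W'A WE rE] W'W]]]] := split_chain WA Wk W0.
have [||s [s1 s2 s3]] := IH W' _ W'A.
- by move: rW; rewrite rE; lia.
- by apply/eqP; rewrite -submx0 -Wk submxMr.
exists ((u, m) :: s); split; rewrite /= ?m0 ?um ?eqxx ?s1 ?big_cons //=.
- apply: eqmx_trans WE _; apply: adds_eqmx => //.
  exact/eqmx_sym/genmxE.
- by rewrite rE s3.
Qed.

Lemma perm_chain_basis A W s t :
  perm_eq s t -> chain_basis A W s -> chain_basis A W t.
Proof.
move=> st [s1 s2 s3]; split; first by rewrite -(perm_all _ st).
  by rewrite -(perm_big _ st).
by rewrite -(perm_big _ st).
Qed.

Lemma rank_sum_seq (I : Type) (r : seq I) (B : I -> 'M[F]_n) (d : I -> nat) :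
  (forall i, \rank (B i) <= d i)%N ->
  (\rank (\sum_(i <- r) B i)%MS <= \sum_(i <- r) d i)%N.
Proof.
move=> Bd; elim: r => [|i r IH]; first by rewrite !big_nil mxrank0.
rewrite !big_cons (leq_trans (mxrank_adds_leqif _ _)) //.
by rewrite leq_add.
Qed.

(* Both inequalities come from subadditivity of the rank: [W A^j] is spanned by
   the tails of the chains, and [W] by [W A^j] and the heads of the chains. *)
Lemma chain_basis_rank A W s j :
  chain_basis A W s -> \rank (W *m A ^+ j) = (\sum_(x <- s) (x.2 - j))%N.
Proof.
move=> [/allP s1 s2 s3].
have sumsub p (V : 'M_(p, n)) (h : 'rV[F]_n * nat -> 'M[F]_n) :
    {in s, forall x, (h x <= V)%MS} -> ((\sum_(x <- s) h x)%MS <= V)%MS.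
  move=> hV; rewrite big_seq.
  apply: (big_ind (fun X : 'M_n => (X <= V)%MS)) => // [|X Y XV YV].
    exact: sub0mx.
  by rewrite addsmx_sub XV.
have subsum (h : 'rV[F]_n * nat -> 'M[F]_n) x :
    x \in s -> (h x <= \sum_(x <- s) h x)%MS.
  by move=> xs; rewrite (big_rem x) //= addsmxSl.
pose h1 x := <<chain A (x.1 *m A ^+ j) (x.2 - j)>>%MS.
pose h2 x := <<chain A x.1 (minn x.2 j)>>%MS.
have le1 : (\rank (W *m A ^+ j) <= \sum_(x <- s) (x.2 - j))%N.
  have -> : \rank (W *m A ^+ j) =
      \rank ((\sum_(x <- s) <<chain A x.1 x.2>>)%MS *m A ^+ j).
    by rewrite (eqmxMr _ s2).
  apply: (@leq_trans (\rank (\sum_(x <- s) h1 x)%MS)); last first.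
    by apply: rank_sum_seq => x; rewrite mxrank_gen rank_leq_row.
  apply: mxrankS.
  have -> : ((\sum_(x <- s) <<chain A x.1 x.2>>)%MS *m A ^+ j
      :=: \sum_(x <- s) <<<<chain A x.1 x.2>>%MS *m A ^+ j>>)%MS.
    elim: (s) => [|x r IH]; first by rewrite !big_nil mul0mx.
    rewrite !big_cons; apply: eqmx_trans (addsmxMr _ _ _) _.
    by apply: adds_eqmx IH; apply/eqmx_sym/genmxE.
  apply: sumsub => -[v m] xs /=; rewrite genmxE (eqmxMr _ (genmxE _)).
  apply: submx_trans (subsum _ _ xs); rewrite /h1 genmxE /=.
  apply/row_subP => i; rewrite row_mul rowK -mulmx_exprD.
  have [ij|ij] := ltnP (i + j) m.
    rewrite (addnC i) mulmx_exprD.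
    by apply: (chain_subP _ _ _ _ (submx_refl _)); lia.
  have /andP[_ /eqP v0] := s1 _ xs.
  by rewrite (expr_eq0_le ij v0) sub0mx.
have le2 : (\rank W <= \rank (W *m A ^+ j) + \sum_(x <- s) minn x.2 j)%N.
  apply: (@leq_trans (\rank (W *m A ^+ j + \sum_(x <- s) h2 x)%MS)); last first.
    rewrite (leq_trans (mxrank_adds_leqif _ _)) // leq_add2l.
    by apply: rank_sum_seq => x; rewrite mxrank_gen rank_leq_row.
  apply: mxrankS; rewrite s2; apply: sumsub => -[v m] xs /=; rewrite genmxE.
  apply/chain_subP => i im.
  have [ij|ij] := ltnP i j.
    apply: submx_trans (addsmxSr _ _); apply: submx_trans (subsum _ _ xs).
    rewrite /h2 genmxE /=.
    by apply: (chain_subP _ _ _ _ (submx_refl _)); lia.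
  apply: submx_trans (addsmxSl _ _).
  rewrite -(subnK ij) mulmx_exprD submxMr // s2.
  apply: submx_trans (subsum _ _ xs).
  by rewrite genmxE; apply: (chain_subP _ _ _ _ (submx_refl _)) => /=; lia.
(* Splitting each length at [j] turns [le2] into the reverse of [le1]. *)
have e : (\sum_(x <- s) x.2 = \sum_(x <- s) (x.2 - j) + \sum_(x <- s) minn x.2 j)%N.
  by rewrite -big_split /=; apply: eq_bigr => x _; lia.
by apply/eqP; rewrite eqn_leq le1 /=; move: le2; rewrite s3 e; lia.
Qed.


(** The sum has at most one term and is empty at the last row, so both cases share one formula. *)
Lemma row_jordan_block a m (X : 'M[F]_(m, n)) i :
  row i (jordan_block a m *m X) =
    a *: row i X + \sum_(j < m | i.+1 == j :> nat) row j X.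
Proof.
apply/rowP => c; rewrite !mxE summxE (bigD1 i) //=.
rewrite mxE eqxx mulr1n mulrDl -addrA; congr (_ + _).
rewrite [in RHS]big_mkcond /= [RHS](bigD1 i) //=.
congr (_ + _); first by rewrite !mxE; case: eqP => _; rewrite ?mul1r ?mul0r.
apply: eq_bigr => j; rewrite eq_sym => /negbTE ij; rewrite !mxE ij mulr0n add0r.
by case: eqP => _; rewrite ?mul1r ?mul0r.
Qed.

Lemma chain_jordan A u m :
  u *m A ^+ m = 0 -> chain A u m *m A = jordan_block 0 m *m chain A u m.
Proof.
move=> um; apply/row_matrixP => i.
rewrite row_jordan_block scale0r add0r row_mul rowK -mulmx_exprSr.
have [im|mi] := ltnP i.+1 m.
  by rewrite (big_pred1 (Ordinal im)) ?rowK.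
rewrite (expr_eq0_le mi um) big_pred0 // => j.
by apply/negbTE; rewrite neq_ltn (leq_trans (ltn_ord j) mi) orbT.
Qed.

Definition nilpotent_blocks (l : seq nat) : seq (F * nat) := [seq (0, m) | m <- l].

Lemma unzip2_nilpotent_blocks l : unzip2 (nilpotent_blocks l) = l.
Proof. by rewrite /unzip2 -map_comp map_id. Qed.

Lemma sum_nth_blocks (b : seq (F * nat)) :
  (\sum_(i < size b) (nth (0%R, 0) b i).2)%N = sumn (unzip2 b).
Proof. by rewrite sumnE big_map (big_nth (0, 0%N)) big_mkord. Qed.

Lemma chain_basis_jordan A W s (b := nilpotent_blocks (unzip2 s)) :
  chain_basis A W s ->
  exists P : 'M_(_, n), [/\ row_free P, (P :=: W)%MS & P *m A = jordan_mx b *m P].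
Proof.
move=> [/allP s1 s2 s3].
pose P := \mxcol_(i < size b) chain A (nth (0, 0%N) s i).1 (nth (0, 0%N) b i).2.
have szb : size b = size s by rewrite /b !size_map.
have nthb i : (i < size s)%N -> nth (0, 0%N) b i = (0, (nth (0, 0%N) s i).2).
  by move=> si; rewrite (nth_map 0%N) ?size_map // (nth_map (0, 0%N)).
have PW : (P :=: W)%MS.
  apply: eqmx_trans (eqmx_col _) _; apply: eqmx_trans (eqmx_sym s2).
  rewrite (big_nth (0, 0%N)) big_mkord.
  (* Passing through natural number indices changes the range from [size b] to [size s] without a
     cast. *)
  rewrite -(big_mkord xpredT (fun i =>
    <<chain A (nth (0, 0%N) s i).1 (nth (0, 0%N) b i).2>>%MS)) szb big_mkord.
  by under eq_bigr => i _ do rewrite nthb //.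
exists P; split=> //.
  rewrite /row_free PW s3 sum_nth_blocks unzip2_nilpotent_blocks.
  by rewrite sumnE big_map.
rewrite mxcol_mul mul_mxdiag_mxcol; apply: eq_mxcol => i.
have si : (i < size s)%N by rewrite -szb.
rewrite nthb //=; apply: chain_jordan.
by have /andP[_ /eqP] := s1 _ (mem_nth (0, 0%N) si).
Qed.

(** The last row of [X] is an eigenvector for [a], so [A ^+ k = 0] forces [a ^+ k = 0]. *)
Lemma jordan_block_eigenvalue A a m (X : 'M[F]_(m, n)) k :
    (0 < m)%N -> X *m A = jordan_block a m *m X -> A ^+ k = 0 ->
    (forall i, row i X != 0) ->
  a = 0.
Proof.
move=> m0 XA Ak X0.
have lm : (m.-1 < m)%N by rewrite prednK.
have lastA : row (Ordinal lm) X *m A = a *: row (Ordinal lm) X.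
  rewrite -row_mul XA row_jordan_block big_pred0 ?addr0 // => j /=.
  by rewrite prednK //; apply/negbTE; rewrite neq_ltn ltn_ord orbT.
have iterA i : row (Ordinal lm) X *m A ^+ i = a ^+ i *: row (Ordinal lm) X.
  elim: i => [|i IH]; first by rewrite !expr0 mulmx1 scale1r.
  by rewrite mulmx_exprSr IH -scalemxAl lastA scalerA exprSr.
have /eqP := iterA k; rewrite Ak mulmx0 eq_sym scaler_eq0 (negbTE (X0 _)) orbF.
by rewrite expf_eq0 => /andP[_ /eqP].
Qed.

(** Each row of [X] is mapped to the next one and the last row to 0, so the first row generates the
    chain. *)
Lemma jordan_block_chain A m (X : 'M[F]_(m, n)) :
    (0 < m)%N -> X *m A = jordan_block 0 m *m X ->
  exists2 u, u *m A ^+ m = 0 & X = chain A u m.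
Proof.
move=> m0 XA.
have rowA i : row i X *m A = \sum_(j < m | i.+1 == j :> nat) row j X.
  by rewrite -row_mul XA row_jordan_block scale0r add0r.
have rowE i (im : (i < m)%N) : row (Ordinal im) X = row (Ordinal m0) X *m A ^+ i.
  elim: i im => [|i IH] im.
    by rewrite expr0 mulmx1; congr row; apply: val_inj.
  by rewrite mulmx_exprSr -(IH (ltnW im)) rowA (big_pred1 (Ordinal im)).
exists (row (Ordinal m0) X); last first.
  by apply/row_matrixP => -[i im]; rewrite rowK rowE.
have lm : (m.-1 < m)%N by rewrite prednK.
rewrite -[in A ^+ m](prednK m0) mulmx_exprSr -(rowE _ lm) rowA.
rewrite big_pred0 // => j /=; rewrite prednK //.
by apply/negbTE; rewrite neq_ltn ltn_ord orbT.
Qed.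

Lemma row_free_neq0 p (P : 'M[F]_(p, n)) i : row_free P -> row i P != 0.
Proof.
move=> Pfree; apply/eqP => P0.
have /matrixP/(_ 0 i)/eqP : delta_mx 0 i = 0 :> 'rV[F]_p.
  by rewrite -[LHS]mulmx1 -(mulmxVp Pfree) mulmxA -rowE P0 mul0mx.
by rewrite !mxE !eqxx oner_eq0.
Qed.

Lemma submxcol_jordan A b (P : 'M[F]_(_, n)) i :
    P *m A = jordan_mx b *m P ->
  submxcol P i *m A =
    jordan_block (nth (0, 0%N) b i).1 (nth (0, 0%N) b i).2 *m submxcol P i.
Proof.
by move=> PA; rewrite submxcol_mul PA -{1}(submxcolK P) mul_mxdiag_mxcol mxcolK.
Qed.

Lemma jordan_eigenvalues A b k (P : 'M[F]_(_, n)) :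
    all (fun x => 0 < x.2)%N b -> A ^+ k = 0 -> row_free P ->
    P *m A = jordan_mx b *m P ->
  all (fun x => x.1 == 0) b.
Proof.
move=> /allP b0 Ak Pfree PA; apply/(all_nthP (0, 0%N)) => i ib; apply/eqP.
apply: (jordan_block_eigenvalue _ (submxcol_jordan (Ordinal ib) PA) Ak) => [|j].
  by apply: b0; rewrite mem_nth.
by rewrite row_rowsub row_free_neq0.
Qed.

(** Converse of [chain_basis_jordan] on the whole space: it opens any given Jordan form with
    eigenvalues 0 to the rank formula of [chain_basis_rank]. *)
Lemma jordan_chain_basis A b (P : 'M[F]_(_, n)) :
    all (fun x => 0 < x.2)%N b -> all (fun x => x.1 == 0) b ->
    row_free P -> row_full P -> P *m A = jordan_mx b *m P ->
  exists2 s, chain_basis A 1%:M s & unzip2 s = unzip2 b.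
Proof.
move=> /allP b0 /allP eig0 Pfree Pfull PA.
have [i|u uE] := fin_all_exists (P := fun (i : 'I_(size b)) u =>
    u *m A ^+ (nth (0, 0%N) b i).2 = 0 /\
    submxcol P i = chain A u (nth (0, 0%N) b i).2).
  have bi := mem_nth (0, 0%N) (ltn_ord i).
  have := submxcol_jordan i PA; rewrite (eqP (eig0 _ bi)).
  by case/(jordan_block_chain (b0 _ bi)) => u uk uE; exists u.
pose s := [seq (u i, (nth (0, 0%N) b i).2) | i <- enum 'I_(size b)].
have sb : unzip2 s = unzip2 b.
  rewrite /unzip2 -[in RHS](mkseq_nth (0, 0%N) b) /mkseq -val_enum_ord -!map_comp.
  exact: eq_map.
exists s => //; split.
- rewrite all_map; apply/allP => i _ /=; rewrite (uE i).1 eqxx andbT.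
  by apply: b0; rewrite mem_nth.
- rewrite big_map big_enum /=; apply: eqmx_trans (_ : (P :=: _)%MS).
    by apply/eqmxP; rewrite submx1 sub1mx andbT.
  suff -> : P = \mxcol_i chain A (u i) (nth (0, 0%N) b i).2 by apply: eqmx_col.
  by rewrite -[LHS]submxcolK; apply: eq_mxcol => i; rewrite (uE i).2.
- rewrite mxrank1 big_map big_enum /=.
  exact: etrans (esym (eqP Pfull)) (eqP Pfree).
Qed.

End JordanChains.

(** The first difference in [j] counts the entries greater than [j], and the second difference
    counts those equal to [j.+1]. Zeros are invisible to these sums and have to be excluded. *)
Lemma perm_truncated_sums (s t : seq nat) : 0%N \notin s -> 0%N \notin t ->
    (forall j, (\sum_(x <- s) (x - j) = \sum_(x <- t) (x - j))%N) ->
  perm_eq s t.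
Proof.
move=> s0 t0 st.
have cntS r j : (\sum_(x <- r) (x - j) =
    \sum_(x <- r) (x - j.+1) + count (fun x => j < x) r)%N.
  elim: r => [|x r IH]; first by rewrite !big_nil.
  by rewrite !big_cons /= IH; case: ltnP; lia.
have cnt j : count (fun x => j < x)%N s = count (fun x => j < x)%N t.
  by have := st j; rewrite (cntS s) (cntS t) st => /addnI.
have cnt1 r j : (count (fun x => j < x) r =
    count (fun x => j.+1 < x) r + count_mem j.+1 r)%N.
  by elim: r => //= x r ->; case: (ltngtP j.+1 x); case: (ltnP j x); lia.
apply/allP => -[|j] _ /=; first by rewrite !(count_memPn _).
by apply/eqP; have := cnt j; rewrite (cnt1 s) (cnt1 t) cnt => /addnI.
Qed.

(** * Dynamical equivalence of maps on finite sets *)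

Lemma dyn_equivP (X Y : finType) (T : Y -> Y) (S : X -> X) :
  dyn_equiv T S <-> exists2 f : X -> Y, bijective f & forall x, f (S x) = T (f x).
Proof.
split=> [[f [g [fK gK SE]]] | [f [g fK gK] fST]].
  by exists f => [|x]; [exists g | rewrite SE /= gK].
by exists f, g; split=> // x /=; rewrite -fST fK.
Qed.

Lemma dyn_equiv_sym (X Y : finType) (T : Y -> Y) (S : X -> X) :
  dyn_equiv T S -> dyn_equiv S T.
Proof.
by move=> [f [g [fK gK SE]]]; exists g, f; split=> // y /=; rewrite SE /= !gK.
Qed.

Lemma dyn_equiv_trans (X Y Z : finType) (T : Y -> Y) (S : X -> X) (U : Z -> Z) :
  dyn_equiv S T -> dyn_equiv T U -> dyn_equiv S U.
Proof.
move=> [f [g [fK gK TE]]] [f' [g' [fK' gK' UE]]].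
exists (f \o f'), (g' \o g); split; try exact: can_comp.
by move=> z /=; rewrite UE /= TE.
Qed.

Lemma dyn_equiv_iter (X Y : Type) (T : Y -> Y) (S : X -> X) (f : X -> Y) j :
  (forall x, f (S x) = T (f x)) -> forall x, f (iter j S x) = iter j T (f x).
Proof. by move=> fST x; elim: j => //= j <-. Qed.

(** The bijection carries the image of [S^j] onto that of [T^j]. For matrices over a finite field
    this invariant amounts to the rank of the [j]-th power. *)
Lemma card_iter_dyn_equiv (X Y : finType) (T : Y -> Y) (S : X -> X) j :
  dyn_equiv T S -> #|[set iter j T y | y : Y]| = #|[set iter j S x | x : X]|.
Proof.
case/dyn_equivP => f [g fK gK] fST.
rewrite -(card_imset _ (can_inj fK)); apply: eq_card => y.
apply/imsetP/imsetP => [[z _ ->] | [_ /imsetP[x _ ->] ->]].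
  exists (iter j S (g z)); first by apply/imsetP; exists (g z).
  by rewrite (dyn_equiv_iter j fST) gK.
by exists (f x); rewrite // (dyn_equiv_iter j fST).
Qed.

Definition prod_map (X Y : Type) (S : X -> X) (T : Y -> Y) (p : X * Y) :=
  (S p.1, T p.2).

Lemma iter_prod_map (X Y : Type) (S : X -> X) (T : Y -> Y) j p :
  iter j (prod_map S T) p = (iter j S p.1, iter j T p.2).
Proof. by elim: j => [|j /= ->] //; case: p. Qed.

Lemma dyn_equiv_prod_map (X Y Z : finType) (S : X -> X) (T : Y -> Y) (U : Z -> Z) :
  dyn_equiv T U -> dyn_equiv (prod_map S T) (prod_map S U).
Proof.
move=> [f [g [fK gK UE]]].
exists (fun p => (p.1, f p.2)), (fun p => (p.1, g p.2)).
by split=> -[x y] /=; rewrite /prod_map /= ?fK ?gK ?UE.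
Qed.

Lemma card_iter_prod_map (X Y : finType) (S : X -> X) (T : Y -> Y) j :
  #|[set iter j (prod_map S T) p | p : X * Y]| =
    (#|[set iter j S x | x : X]| * #|[set iter j T y | y : Y]|)%N.
Proof.
rewrite -cardsX; apply: eq_card => -[x y].
rewrite !inE /=.
apply/imsetP/andP => [[[x' y'] _] | [/imsetP[x' _ ->] /imsetP[y' _ ->]]].
  by rewrite iter_prod_map => -[-> ->]; split; apply: imset_f.
by exists (x', y'); rewrite // iter_prod_map.
Qed.

(** * Matrices acting on row vectors over a finite field *)

Section MatrixDynamics.

Variable F : finFieldType.

Definition mxact n (A : 'M[F]_n) (v : 'rV[F]_n) : 'rV[F]_n := v *m A.

Lemma iter_mxact n (A : 'M[F]_n) j v : iter j (mxact A) v = v *m A ^+ j.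
Proof.
elim: j => [|j /= ->]; first by rewrite expr0 mulmx1.
by rewrite /mxact -mulmx_exprSr.
Qed.

(** In [A = col_base A *m row_base A] the first factor is onto and the second injective, so the
    image is in bijection with the row vectors of length [\rank A]. *)
Lemma card_mulmx_image n (A : 'M[F]_n) :
  #|[set v *m A | v : 'rV_n]| = (#|F| ^ \rank A)%N.
Proof.
have inj : injective (fun y : 'rV_(\rank A) => y *m row_base A).
  exact: can_inj (mulmxKp (row_base_free A)).
rewrite -[X in (_ ^ X)%N]mul1n -(card_mx F 1 (\rank A)) -cardsT -(card_imset _ inj).
apply: eq_card => v; apply/imsetP/imsetP => [[w _ ->] | [y _ ->]].
  by exists (w *m col_base A); rewrite // -mulmxA mulmx_base.
have /row_fullP[X XA] := col_base_full A; exists (y *m X) => //.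
have XAE : X *m A = row_base A.
  by have := congr1 (mulmx X) (mulmx_base A); rewrite mulmxA XA mul1mx.
by rewrite -mulmxA XAE.
Qed.

Lemma card_iter_mxact n (A : 'M[F]_n) j :
  #|[set iter j (mxact A) v | v : 'rV_n]| = (#|F| ^ \rank (A ^+ j))%N.
Proof.
rewrite -card_mulmx_image; apply: eq_card => v.
by apply/imsetP/imsetP => -[w _ ->]; exists w; rewrite // iter_mxact.
Qed.

Lemma dyn_equiv_conj m n (A : 'M[F]_m) (B : 'M[F]_n) (P : 'M[F]_(m, n)) :
  row_free P -> row_full P -> P *m B = A *m P -> dyn_equiv (mxact B) (mxact A).
Proof.
move=> Pfree Pfull PB; apply/dyn_equivP; exists (fun v => v *m P).
  exists (fun v => v *m pinvmx P) => v; rewrite -mulmxA.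
    by rewrite mulmxVp ?mulmx1.
  by rewrite mulVpmx ?mulmx1.
by move=> v; rewrite /mxact -!mulmxA PB.
Qed.

Definition nilpotent_jordan (l : seq nat) := jordan_mx (nilpotent_blocks F l).

(** The standard basis is a Jordan basis of a Jordan matrix. *)
Lemma nilpotent_jordan_basis l : 0%N \notin l ->
  exists2 s, chain_basis (nilpotent_jordan l) 1%:M s & unzip2 s = l.
Proof.
move=> l0; have [||||//|s sP sl] := @jordan_chain_basis F _
    (nilpotent_jordan l) (nilpotent_blocks F l) 1%:M.
- rewrite all_map; apply/allP => -[|m] //=.
  by move=> ml; rewrite ml in l0.
- by rewrite all_map; apply/allP => m _ /=.
- by rewrite row_free_unit unitmx1.
- by rewrite row_full_unit unitmx1.
- by rewrite mul1mx mulmx1.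
by exists s; rewrite // sl unzip2_nilpotent_blocks.
Qed.

Lemma rank_nilpotent_jordan l j : 0%N \notin l ->
  \rank (nilpotent_jordan l ^+ j) = (\sum_(m <- l) (m - j))%N.
Proof.
case/nilpotent_jordan_basis => s sP sl.
by have := chain_basis_rank j sP; rewrite mul1mx => ->; rewrite -[in RHS]sl big_map.
Qed.

Lemma chain_basis_dyn_equiv n (A B : 'M[F]_n) s t :
    chain_basis A 1%:M s -> chain_basis B 1%:M t ->
    (dyn_equiv (mxact B) (mxact A) <-> perm_eq (unzip2 s) (unzip2 t)).
Proof.
move=> sP tP.
have pos (C : 'M[F]_n) r : chain_basis C 1%:M r -> 0%N \notin unzip2 r.
  by case=> /allP r1 _ _; apply/mapP => -[x /r1 /andP[x0 _] x2]; rewrite -x2 in x0.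
split=> [AB | st].
  apply: perm_truncated_sums => [||j]; [exact: pos sP | exact: pos tP|].
  have := card_iter_dyn_equiv j AB; rewrite !card_iter_mxact => /eqP.
  rewrite eqn_exp2l ?card_finNzRing_gt1 // => /eqP.
  have := chain_basis_rank j sP; have := chain_basis_rank j tP.
  by rewrite !mul1mx !big_map => -> -> ->.
(* The chains of [s] are reordered so that their lengths match those of [t] entry by entry; then [A]
   and [B] are conjugate to literally the same Jordan matrix. *)
have [s' ss' s't] : exists2 s', perm_eq s s' & unzip2 s' = unzip2 t.
  have /(perm_iotaP 0%N)[I] : perm_eq (unzip2 t) (unzip2 s) by rewrite perm_sym.
  rewrite size_map => Iiota tE; exists [seq nth (0, 0%N) s i | i <- I].
    by rewrite perm_sym; apply/(perm_iotaP (0, 0%N)); exists I.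
  rewrite tE /unzip2 -map_comp; apply/eq_in_map => i.
  rewrite (perm_mem Iiota) mem_iota => /andP[_ si] /=.
  by rewrite (nth_map (0, 0%N)).
have := chain_basis_jordan (perm_chain_basis ss' sP).
rewrite s't => -[P [Pfree P1 PA]].
have [Q [Qfree Q1 QB]] := chain_basis_jordan tP.
have full p (X : 'M[F]_(p, n)) : (X :=: 1%:M)%MS -> row_full X.
  by move=> X1; rewrite -sub1mx X1.
have := dyn_equiv_conj Qfree (full _ _ Q1) QB.
move=> /dyn_equiv_trans; apply.
exact: dyn_equiv_sym (dyn_equiv_conj Pfree (full _ _ P1) PA).
Qed.


(** * Fitting's decomposition and its uniqueness *)

(** The row spaces of the powers decrease, so the rank repeats at some [j]; from there on the row
    space no longer changes. *)
Lemma rank_expr_stable n (A : 'M[F]_n) :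
  exists j, forall i, (A ^+ (j + i) :=: A ^+ j)%MS.
Proof.
have [j jE] : exists j, \rank (A ^+ j.+1) = \rank (A ^+ j).
  have [r] := ubnP (\rank (A ^+ 0)); elim: r (0%N) => // r IH j.
  rewrite ltnS => jr.
  have : (\rank (A ^+ j.+1) <= \rank (A ^+ j))%N.
    by rewrite exprS -mulmxE mxrankM_maxr.
  rewrite leq_eqVlt => /orP[/eqP|lt]; first by exists j.
  exact: IH (leq_trans lt jr).
have AjS : (A ^+ j.+1 :=: A ^+ j)%MS.
  by apply/eqmxP; rewrite -(mxrank_leqif_eq _) ?jE // exprS -mulmxE submxMl.
exists j; elim=> [|i IH]; first by rewrite addn0.
apply: eqmx_trans AjS; rewrite addnS !exprSr -!mulmxE; exact: eqmxMr.
Qed.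

(** With [j] from [rank_expr_stable], the space is the direct sum of the kernel of [A^j], where [A]
    is nilpotent, and the row space of [A^j], where [A] is bijective. *)
Lemma fitting n (A : 'M[F]_n) : exists s m (B : 'M[F]_m),
  [/\ sorted geq s, 0%N \notin s, (sumn s + m)%N = n, B \in unitmx
    & dyn_equiv (mxact A) (prod_map (mxact (nilpotent_jordan s)) (mxact B))].
Proof.
have [j Aj] := rank_expr_stable A.
pose W := kermx (A ^+ j).
have WA : (W *m A <= W)%MS.
  apply/sub_kermxP; rewrite -mulmx_exprS mulmx_exprSr.
  by rewrite (sub_kermxP (submx_refl _)) mul0mx.
have Wj : W *m A ^+ j = 0 by apply: sub_kermxP.
have [s0 /(perm_chain_basis _) s0P] := chain_basis_exists WA Wj.
pose s := sort (relpre snd geq) s0.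
have sP : chain_basis A W s by apply: s0P; rewrite perm_sym perm_sort.
have [P [Pfree PW PA]] := chain_basis_jordan sP.
pose m := \rank (A ^+ j); pose Q := row_base (A ^+ j).
have QAj : (Q :=: A ^+ j)%MS by apply: eq_row_base.
have rQA : \rank (Q *m A) = m.
  rewrite (eqmxMr _ QAj) -[A ^+ j *m A]/(A ^+ j * A) -exprSr -addn1.
  by rewrite (Aj 1%N).
(* [B] is the matrix of [A] on its stable image, in the basis [Q]. *)
pose B := Q *m A *m pinvmx Q.
have QA : Q *m A = B *m Q.
  rewrite mulmxKpV // QAj (eqmxMr _ QAj) -[A ^+ j *m A]/(A ^+ j * A) -exprSr -addn1.
  by rewrite (Aj 1%N).
have Bunit : B \in unitmx.
  rewrite -row_free_unit /row_free eqn_leq rank_leq_row.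
  by rewrite -[X in (X <= _)%N]rQA QA mxrankM_maxl.
have Qfree : row_free Q := row_base_free _.
clearbody B Q.
(* [A^j] and [A^(j+j)] have equal rank, so [A^j] is injective on its own image. *)
have WQ0 : (W :&: Q)%MS = 0.
  apply/eqP; rewrite -mxrank_eq0 capmxC (cap_eqmx QAj (eqmx_refl _)).
  have := mxrank_mul_ker (A ^+ j) (A ^+ j).
  rewrite mulmxE -exprD (Aj j) -[X in _ = X]addn0 => /eqP.
  by rewrite eqn_add2l.
have s0l : 0%N \notin unzip2 s.
  case: sP => /allP s1 _ _; apply/mapP => -[x /s1 /andP[x0 _] x2].
  by rewrite -x2 in x0.
have sumE : (sumn (unzip2 s) + m)%N = n.
  case: sP => _ _; rewrite sumnE big_map => <-.
  by rewrite mxrank_ker subnK // rank_leq_row.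
exists (unzip2 s), m, B; split=> //.
  rewrite /unzip2 -sort_map; apply: sort_sorted => x y; exact: leq_total.
apply/dyn_equivP.
have Rfree : row_free (col_mx P Q).
  rewrite /row_free -addsmxE.
  have := mxrank_sum_cap P Q; rewrite (cap_eqmx PW (eqmx_refl _)) WQ0 mxrank0 addn0.
  by move->; rewrite (eqP Pfree) (eqP Qfree).
exists (fun p => row_mx p.1 p.2 *m col_mx P Q).
  (* Comparing cardinals replaces the construction of an inverse, which would need a cast between
     the two dimensions. *)
  apply: inj_card_bij => [[x y] [x' y'] /=|].
    by move=> /(can_inj (mulmxKp Rfree)) /eq_row_mx[-> ->].
  rewrite card_prod !card_mx !mul1n -expnD leq_exp2l ?card_finNzRing_gt1 //.
  by rewrite sum_nth_blocks unzip2_nilpotent_blocks sumE.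
by move=> [x y]; rewrite /prod_map /mxact /= !mul_row_col mulmxDl -!mulmxA PA QA.
Qed.

(** Used to realise every pair of a partition and a bijective class. The separate [n] absorbs the
    dimension of [nilpotent_jordan], a sum over blocks. *)
Lemma dyn_equiv_block a m n (J : 'M[F]_a) (B : 'M[F]_m) : (a + m)%N = n ->
  exists A : 'M[F]_n, dyn_equiv (mxact A) (prod_map (mxact J) (mxact B)).
Proof.
move=> <-; exists (block_mx J 0 0 B); apply/dyn_equivP.
exists (fun p => row_mx p.1 p.2).
  exists (fun v => (lsubmx v, rsubmx v)) => [[x y]|v] /=.
    by rewrite row_mxKl row_mxKr.
  exact: hsubmxK.
by move=> [x y]; rewrite /mxact /= mul_row_block !mulmx0 addr0 add0r.
Qed.

Lemma unitmx_expr n (B : 'M[F]_n) j : B \in unitmx -> B ^+ j \in unitmx.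
Proof.
move=> Bu; elim: j => [|j IH]; first by rewrite expr0 unitmx1.
by rewrite exprS -mulmxE unitmx_mul Bu.
Qed.

(* [(0, y)] is a [k]-th iterate because [B] is invertible, and iterating [k]
   times kills the first component on the other side. *)
Lemma prod_map_unit_part a a' m m' (J : 'M[F]_a) (J' : 'M[F]_a')
    (B : 'M[F]_m) (B' : 'M[F]_m') f k :
    J' ^+ k = 0 -> B \in unitmx ->
    (forall p, f (prod_map (mxact J) (mxact B) p) =
       prod_map (mxact J') (mxact B') (f p)) ->
  forall y, (f (0, y)).1 = 0.
Proof.
move=> Jk Bu fE y.
have -> : (0, y) = iter k (prod_map (mxact J) (mxact B)) (0, y *m invmx (B ^+ k)).
  by rewrite iter_prod_map !iter_mxact /= mul0mx mulmxKV // unitmx_expr.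
by rewrite (dyn_equiv_iter k fE) iter_prod_map /= iter_mxact Jk mulmx0.
Qed.

(** By [prod_map_unit_part], [f] and its inverse both preserve the vectors with nilpotent component
    0, so [f] restricts to a bijection between them. *)
Lemma dyn_equiv_unit_part a a' m m' (J : 'M[F]_a) (J' : 'M[F]_a')
    (B : 'M[F]_m) (B' : 'M[F]_m') k k' :
    J ^+ k = 0 -> J' ^+ k' = 0 -> B \in unitmx -> B' \in unitmx ->
    dyn_equiv (prod_map (mxact J') (mxact B')) (prod_map (mxact J) (mxact B)) ->
  dyn_equiv (mxact B') (mxact B).
Proof.
move=> Jk Jk' Bu Bu' /dyn_equivP[f [g fK gK] fE].
have gE p : g (prod_map (mxact J') (mxact B') p) = prod_map (mxact J) (mxact B) (g p).
  by rewrite -{1}[p]gK -fE fK.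
have f0 := prod_map_unit_part Jk' Bu fE; have g0 := prod_map_unit_part Jk Bu' gE.
have fy y : (0, (f (0, y)).2) = f (0, y) by rewrite -(f0 y); case: (f _).
have gy y : (0, (g (0, y)).2) = g (0, y) by rewrite -(g0 y); case: (g _).
apply/dyn_equivP; exists (fun y => (f (0, y)).2).
  by exists (fun y => (g (0, y)).2) => y; rewrite ?fy ?gy ?fK ?gK.
move=> y; have := congr1 snd (fE (0, y)).
by rewrite /prod_map /= {1}/mxact mul0mx.
Qed.

Lemma fitting_unique l l' m m' (B : 'M[F]_m) (B' : 'M[F]_m') :
    sorted geq l -> sorted geq l' -> 0%N \notin l -> 0%N \notin l' ->
    B \in unitmx -> B' \in unitmx ->
    dyn_equiv (prod_map (mxact (nilpotent_jordan l')) (mxact B'))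
              (prod_map (mxact (nilpotent_jordan l)) (mxact B)) ->
  [/\ l = l', m = m' & dyn_equiv (mxact B') (mxact B)].
Proof.
move=> lS lS' l0 l0' Bu Bu' E.
have sumE j : (\sum_(x <- l') (x - j) + m' = \sum_(x <- l) (x - j) + m)%N.
  have := card_iter_dyn_equiv j E.
  rewrite !card_iter_prod_map !card_iter_mxact -!expnD.
  rewrite (mxrank_unit (unitmx_expr j Bu)) (mxrank_unit (unitmx_expr j Bu')).
  rewrite !rank_nilpotent_jordan // => /eqP.
  by rewrite eqn_exp2l ?card_finNzRing_gt1 // => /eqP.
have sum0 r j : (sumn r <= j)%N -> (\sum_(x <- r) (x - j))%N = 0%N.
  elim: r => [|x r IH] /= rj; first by rewrite big_nil.
  by rewrite big_cons IH; lia.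
(* At [j = sumn l + sumn l'] all truncated sums vanish, which leaves the dimensions of the bijective
   parts. *)
have mm : m = m'.
  by have := sumE (sumn l + sumn l')%N; rewrite !sum0 ?leq_addl ?leq_addr.
have nil r : 0%N \notin r -> nilpotent_jordan r ^+ sumn r = 0.
  move=> r0; apply/eqP; rewrite -mxrank_eq0 rank_nilpotent_jordan //.
  by rewrite sum0.
split=> //; last exact: dyn_equiv_unit_part (nil _ l0) (nil _ l0') Bu Bu' E.
apply: (@sorted_eq _ geq) => //.
- by move=> x y z /= xy yz; apply: leq_trans yz xy.
- by move=> x y /= /anti_leq.
apply: perm_truncated_sums => // j; apply/eqP.
by have := sumE j; rewrite -mm => /addIn ->.
Qed.

End MatrixDynamics.

(** * Functional graphs and the counting of isomorphism classes *)

Lemma mem_functional_graph (V : finType) (T : V -> V) u v :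
  ((u, v) \in functional_graph T) = (v == T u).
Proof.
apply/imsetP/eqP => [[w _ [-> ->]] // | ->].
by exists u.
Qed.

Lemma eq_functional_graph (V : finType) (S T : V -> V) :
  S =1 T -> functional_graph S = functional_graph T.
Proof. by move=> ST; apply: eq_imset => v; rewrite ST. Qed.

Lemma digraph_isoP (V : finType) (G H : {set V * V}) :
  reflect (exists s : {perm V},
             forall u v, ((u, v) \in G) = ((s u, s v) \in H))
          (digraph_iso G H).
Proof.
apply: (iffP existsP) => -[s sP]; exists s.
  by move=> u v; move/forallP/(_ u)/forallP/(_ v)/eqP: sP.
by apply/forallP => u; apply/forallP => v; rewrite sP.
Qed.

Lemma digraph_iso_equivalence (V : finType) : equivalence_rel (@digraph_iso V).
Proof.
have sym (G H : {set V * V}) : digraph_iso G H -> digraph_iso H G.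
  case/digraph_isoP => s sP; apply/digraph_isoP; exists (s^-1)%g => u v.
  by rewrite sP !permKV.
have trans (G H K : {set V * V}) :
    digraph_iso G H -> digraph_iso H K -> digraph_iso G K.
  case/digraph_isoP => s sP /digraph_isoP[t tP]; apply/digraph_isoP.
  by exists (s * t)%g => u v; rewrite sP tP !permM.
move=> G H K; split.
  by apply/digraph_isoP; exists 1%g => u v; rewrite !perm1.
by move=> GH; apply/idP/idP; apply: trans => //; apply: sym.
Qed.

(** Each vertex has exactly one outgoing edge, so preserving the edges [(u, S u)] already means
    commuting with the maps. *)
Lemma functional_graph_iso (V : finType) (S T : V -> V) :
  digraph_iso (functional_graph S) (functional_graph T) <-> dyn_equiv T S.
Proof.
split=> [/digraph_isoP[s sP] | /dyn_equivP[f fbij fE]].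
  apply/dyn_equivP; exists s => [|u].
    by exists (s^-1)%g; [apply: permK | apply: permKV].
  by have := sP u (S u); rewrite !mem_functional_graph eqxx => /esym/eqP.
apply/digraph_isoP; exists (perm (bij_inj fbij)) => u v.
by rewrite !mem_functional_graph !permE -fE (inj_eq (bij_inj fbij)).
Qed.

(** Complete invariants serve as the index set [K]: [g] picks a representative for each, and the
    classes of the [g y] exhaust the partition without repetition. *)
Lemma card_equivalence_partition (I J : finType) (R : rel I) (D : {set I})
    (K : {set J}) (g : J -> I) :
    equivalence_rel R -> {in K, forall y, g y \in D} ->
    {in D, forall x, exists2 y, y \in K & R x (g y)} ->
    {in K &, forall y y', R (g y) (g y') -> y = y'} ->
  #|equivalence_partition R D| = #|K|.
Proof.
move=> eqR gD gonto ginj; have Rxx x : R x x by case: (eqR x x x).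
pose cl x := [set z in D | R x z].
have clE x x' : R x x' -> cl x = cl x'.
  move=> xx'; apply/setP => z; rewrite !inE; case: (eqR x x' z) => _ /(_ xx') ->.
  by [].
have -> : equivalence_partition R D = [set cl (g y) | y in K].
  apply/setP => c; apply/imsetP/imsetP => [[x xD ->] | [y yK ->]].
    by have [y yK xy] := gonto x xD; exists y => //; apply: clE.
  by exists (g y) => //; apply: gD.
rewrite card_in_imset // => y y' yK y'K /setP/(_ (g y')).
rewrite !inE gD //= Rxx => yy'; exact: ginj.
Qed.

Lemma equivalence_classE (I : finType) (R : rel I) (D c : {set I}) x :
    equivalence_rel R -> c \in equivalence_partition R D -> x \in c ->
  x \in D /\ c = [set z in D | R x z].
Proof.
move=> eqR /imsetP[y yD ->]; rewrite inE => /andP[xD yx]; split=> //.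
by apply/setP => z; rewrite !inE; case: (eqR y x z) => _ /(_ yx) ->.
Qed.

(** * The counting formula for linear maps *)

Section Counting.

Variable F : finFieldType.

Lemma linear_mapsP n (T : {ffun 'rV[F]_n -> 'rV[F]_n}) :
  reflect (exists A : 'M_n, T =1 mxact A) (T \in linear_maps F n).
Proof.
rewrite inE; apply: (iffP forallP) => [Tlin | [A TA] a].
  have lin : linear T.
    by move=> a u v; move: (Tlin a) => /forallP/(_ u)/forallP/(_ v)/eqP.
  pose T' : {linear 'rV[F]_n -> 'rV[F]_n} :=
    HB.pack (T : 'rV[F]_n -> 'rV[F]_n) (GRing.isLinear.Build F _ _ _ T lin).
  by exists (lin1_mx T') => v; rewrite /mxact mul_rV_lin1.
apply/forallP => u; apply/forallP => v.
by rewrite !TA /mxact mulmxDl scalemxAl.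
Qed.

Lemma bijective_linear_mapsP n (T : {ffun 'rV[F]_n -> 'rV[F]_n}) :
  reflect (exists2 A : 'M_n, A \in unitmx & T =1 mxact A)
          (T \in bijective_linear_maps F n).
Proof.
rewrite inE; apply: (iffP andP) => [[/linear_mapsP[A TA] /andP[/injectiveP Tinj _]]|].
  exists A => //; rewrite -row_free_unit -kermx_eq0; apply/rowV0P => v /sub_kermxP vA.
  by apply: Tinj; rewrite !TA /mxact vA mul0mx.
case=> A Au TA; split; first by apply/linear_mapsP; exists A.
apply/andP; split.
  by apply/injectiveP => u v; rewrite !TA => /(can_inj (mulmxK Au)).
apply/forallP => w; apply/existsP; exists (w *m invmx A).
by rewrite TA /mxact mulmxKV.
Qed.

Definition linear_graphs n :=
  [set functional_graph T | T : {ffun 'rV[F]_n -> 'rV[F]_n} in linear_maps F n].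

Definition bijective_linear_graphs n :=
  [set functional_graph T
    | T : {ffun 'rV[F]_n -> 'rV[F]_n} in bijective_linear_maps F n].

Lemma linear_graphsP n G :
  reflect (exists A : 'M_n, G = functional_graph (mxact A)) (G \in linear_graphs n).
Proof.
apply: (iffP imsetP) => [[T /linear_mapsP[A TA] ->] | [A ->]].
  by exists A; apply: eq_functional_graph.
exists [ffun v => mxact A v]; last by apply: eq_functional_graph => v; rewrite ffunE.
by apply/linear_mapsP; exists A => v; rewrite ffunE.
Qed.

Lemma bijective_linear_graphsP n G :
  reflect (exists2 A : 'M_n, A \in unitmx & G = functional_graph (mxact A))
          (G \in bijective_linear_graphs n).
Proof.
apply: (iffP imsetP) => [[T /bijective_linear_mapsP[A Au TA] ->] | [A Au ->]].
  by exists A => //; apply: eq_functional_graph.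
exists [ffun v => mxact A v]; last by apply: eq_functional_graph => v; rewrite ffunE.
by apply/bijective_linear_mapsP; exists A => // v; rewrite ffunE.
Qed.

Definition partitions k := [set s : k.-bseq 'I_k.+1 |
  [&& sorted geq (map val s), 0%N \notin map val s & sumn (map val s) == k]].

Lemma partitions_onto k l :
    sorted geq l -> 0%N \notin l -> sumn l = k ->
  exists2 s : k.-bseq 'I_k.+1, s \in partitions k & map val s = l.
Proof.
move=> lS l0 lk.
have le_sumn r x : x \in r -> (x <= sumn r)%N.
  elim: r => //= y r IH; rewrite inE => /predU1P[->|/IH xr]; first exact: leq_addr.
  exact: leq_trans xr (leq_addl _ _).
have le_size r : 0%N \notin r -> (size r <= sumn r)%N.
  elim: r => //= y r IH; rewrite inE negb_or => /andP[y0 /IH]; lia.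
have sizel : (size (map (inord : nat -> 'I_k.+1) l) <= k)%N.
  by rewrite size_map -lk le_size.
have lE : map val (map (inord : nat -> 'I_k.+1) l) = l.
  rewrite -map_comp -[RHS]map_id; apply/eq_in_map => x /le_sumn xl /=.
  by rewrite inordK // ltnS -lk.
exists (Bseq sizel); last exact: lE.
by rewrite inE /= lE lS l0 lk eqxx.
Qed.


Definition bijective_classes n :=
  equivalence_partition (@digraph_iso 'rV[F]_n) (bijective_linear_graphs n).

Lemma bijective_class_mem n c : c \in bijective_classes n ->
  exists2 B : 'M_n, B \in unitmx & functional_graph (mxact B) \in c.
Proof.
case/imsetP => G GD ->; have [B Bu GB] := bijective_linear_graphsP _ GD.
exists B => //; rewrite -GB !inE; apply/andP; split=> //.
by case: (digraph_iso_equivalence G G G).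
Qed.

Lemma bijective_class_dyn_equiv n c (B B' : 'M_n) : c \in bijective_classes n ->
    functional_graph (mxact B) \in c -> functional_graph (mxact B') \in c ->
  dyn_equiv (mxact B') (mxact B).
Proof.
move=> cP Bc; have [_ ->] := equivalence_classE (@digraph_iso_equivalence _) cP Bc.
by rewrite inE => /andP[_ /functional_graph_iso].
Qed.

Lemma bijective_class_exists n (B : 'M_n) : B \in unitmx ->
  exists2 c, c \in bijective_classes n & functional_graph (mxact B) \in c.
Proof.
move=> Bu; have BD : functional_graph (mxact B) \in bijective_linear_graphs n.
  by apply/bijective_linear_graphsP; exists B.
eexists; first by apply: imset_f BD.
rewrite !inE BD /=.
by case: (digraph_iso_equivalence set0 set0 (functional_graph (mxact B))).
Qed.

Lemma bijective_class_inj n c c' (B B' : 'M_n) :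
    c \in bijective_classes n -> c' \in bijective_classes n ->
    functional_graph (mxact B) \in c -> functional_graph (mxact B') \in c' ->
    dyn_equiv (mxact B') (mxact B) ->
  c = c'.
Proof.
move=> cP cP' Bc Bc' /functional_graph_iso BB'.
have [_ ->] := equivalence_classE (@digraph_iso_equivalence _) cP Bc.
have [_ ->] := equivalence_classE (@digraph_iso_equivalence _) cP' Bc'.
apply/setP => G; rewrite !inE.
case: (digraph_iso_equivalence (functional_graph (mxact B))
  (functional_graph (mxact B')) G).
by move=> _ /(_ BB') ->.
Qed.

Lemma num_linear_graphsE n : num_linear_graphs F n =
  (\sum_(0 <= k < n.+1)
     num_partitions k * num_bijective_linear_graphs F (n - k))%N.
Proof.
(* The complete invariants: [k] is the dimension of the nilpotent part, with a partition of [k] and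
   a class of bijective graphs in dimension [n - k]. The last two have types depending on [k], hence
   a sigma type. *)
pose J := {k : 'I_n.+1 &
  (k.-bseq 'I_k.+1 * {set {set 'rV[F]_(n - k) * 'rV[F]_(n - k)}})%type}.
pose K := [set y : J | ((tagged y).1 \in partitions (tag y)) &&
                       ((tagged y).2 \in bijective_classes (n - tag y))].
pose lens (y : J) : seq nat := map val (tagged y).1.
pose realizes (y : J) G := exists (A : 'M[F]_n) (B : 'M[F]_(n - tag y)),
  [/\ G = functional_graph (mxact A), B \in unitmx,
      functional_graph (mxact B) \in (tagged y).2
    & dyn_equiv (mxact A)
        (prod_map (mxact (nilpotent_jordan F (lens y))) (mxact B))].
have lensP y : y \in K ->
    [/\ sorted geq (lens y), 0%N \notin lens y & sumn (lens y) = tag y].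
  by rewrite !inE => /andP[/and3P[? ? /eqP ?] _].
have clP y : y \in K -> (tagged y).2 \in bijective_classes (n - tag y).
  by rewrite inE => /andP[].
(* Finite choice of one graph for each invariant; outside [K] the value [set0] is arbitrary. *)
have [y|g gP] := fin_all_exists (P := fun (y : J) G => y \in K -> realizes y G).
  have [yK|] := boolP (y \in K); last by exists set0.
  have [_ _ sl] := lensP y yK; have [B Bu Bc] := bijective_class_mem (clP y yK).
  have [|A AB] := @dyn_equiv_block F _ _ n (nilpotent_jordan F (lens y)) B.
    by rewrite sum_nth_blocks unzip2_nilpotent_blocks sl subnKC // -ltnS.
  by exists (functional_graph (mxact A)); exists A, B.
transitivity #|K|.
  apply: (card_equivalence_partition (g := g) (@digraph_iso_equivalence _)).
  - by move=> y /gP[A [B [-> _ _ _]]]; apply/linear_graphsP; exists A.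
  - move=> _ /linear_graphsP[A ->].
    have [s [m [B [sS s0 sm Bu AB]]]] := fitting A.
    have sn : (sumn s < n.+1)%N by lia.
    have mE : m = (n - sumn s)%N by lia.
    (* After the substitution [B] has dimension [n - sumn s], as the second component of [J]
       demands. *)
    subst m; have [p pP ps] := partitions_onto sS s0 (erefl (sumn s)).
    have [c cP Bc] := bijective_class_exists Bu.
    pose y : J := existT _ (Ordinal sn) (p, c).
    have yK : y \in K by rewrite inE pP cP.
    exists y => //; have [A' [B' [-> Bu' Bc' AB']]] := gP y yK.
    apply/functional_graph_iso; apply: dyn_equiv_trans AB' _.
    rewrite /lens ps; apply: dyn_equiv_trans (dyn_equiv_sym AB).
    exact: dyn_equiv_prod_map (bijective_class_dyn_equiv cP Bc Bc').
  - move=> y y' yK y'K.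
    have [A [B [-> Bu Bc AB]]] := gP y yK.
    have [A' [B' [-> Bu' Bc' AB']]] := gP y' y'K.
    move=> /functional_graph_iso AA'.
    have BB := dyn_equiv_trans (dyn_equiv_sym AB') (dyn_equiv_trans AA' AB).
    have [lS l0 ly] := lensP y yK; have [lS' l0' ly'] := lensP y' y'K.
    have [ll _ {}BB] := fitting_unique lS lS' l0 l0' Bu Bu' BB.
    have cP := clP y yK; have cP' := clP y' y'K.
    (* The equality of [k] and [k'] has to be eliminated before the dependent components can be
       compared, so whatever depends on them is cleared or generalised first. *)
    clear A A' AB AB' AA' lS lS' l0 l0' yK y'K Bu Bu' gP.
    move: y y' ly ly' ll B B' Bc Bc' BB cP cP' => [k [p c]] [k' [p' c']].
    rewrite /lens /= => kE k'E ll.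
    have kk : k = k' by apply: val_inj; rewrite /= -kE -k'E ll.
    case: k' / kk p' c' {k'E} ll => p' c' /(inj_map val_inj)/val_inj <-.
    by move=> B B' Bc Bc' BB cP cP'; rewrite (bijective_class_inj cP cP' Bc Bc' BB).
rewrite big_mkord -sum1_card.
under [RHS]eq_bigr => k _ do
  rewrite /num_partitions -/(partitions k) /num_bijective_linear_graphs
    /num_iso_classes -/(bijective_classes (n - k)) -cardsX -sum1_card.
rewrite sig_big_dep /=; apply: eq_bigl => -[k [p c]].
by rewrite !inE.
Qed.

(** * Jordan forms of nilpotent linear maps *)

Lemma eq_dyn_equiv (X Y : finType) (T T' : Y -> Y) (S S' : X -> X) :
  T =1 T' -> S =1 S' -> dyn_equiv T S <-> dyn_equiv T' S'.
Proof.
move=> TT SS; split=> -[f [g [fK gK E]]]; exists f, g; split=> // x.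
  by rewrite -SS E /= TT.
by rewrite SS E /= TT.
Qed.

Lemma nilpotent_lin1_mx n (S : {linear 'rV[F]_n -> 'rV[F]_n}) :
  nilpotent_map S -> exists k, lin1_mx S ^+ k = 0.
Proof.
case=> k Sk; exists k; apply/row_matrixP => i; rewrite rowE row0 -iter_mxact.
rewrite -[RHS](Sk (delta_mx 0 i)); apply: eq_iter => v.
exact: mul_rV_lin1.
Qed.

Lemma nilpotent_jordan_form n (S : {linear 'rV[F]_n -> 'rV[F]_n}) :
  nilpotent_map S -> exists b, jordan_form S b.
Proof.
move=> /nilpotent_lin1_mx[k Sk].
have [||s sP] := @chain_basis_exists F n (lin1_mx S) 1%:M k.
- exact: submx1.
- by rewrite Sk mulmx0.
have [P [Pfree P1 PS]] := chain_basis_jordan sP.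
exists (nilpotent_blocks F (unzip2 s)); split.
  have [/allP s1 _ _] := sP; rewrite all_map all_map; apply/allP => x /s1 /=.
  by case/andP.
by exists P; split=> //; rewrite -sub1mx P1.
Qed.

(** A Jordan form allows any eigenvalues in [F]; nilpotency makes them 0, and the blocks then become
    chains of the same lengths. *)
Lemma jordan_form_chain_basis n (S : {linear 'rV[F]_n -> 'rV[F]_n}) b :
    nilpotent_map S -> jordan_form S b ->
  exists2 s, chain_basis (lin1_mx S) 1%:M s & unzip2 s = unzip2 b.
Proof.
move=> /nilpotent_lin1_mx[k Sk] [b0 [P [Pfree Pfull PS]]].
apply: (jordan_chain_basis b0 _ Pfree Pfull PS).
exact: jordan_eigenvalues b0 Sk Pfree PS.
Qed.

End Counting.

Theorem theorem2 (F : finFieldType) (n : nat) :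
  (forall S T : {linear 'rV[F]_n -> 'rV[F]_n},
     nilpotent_map S -> nilpotent_map T ->
     (exists bS, jordan_form S bS) /\
     (exists bT, jordan_form T bT) /\
     (forall bS bT, jordan_form S bS -> jordan_form T bT ->
        (dyn_equiv T S <-> perm_eq (unzip2 bS) (unzip2 bT)))) /\
  num_linear_graphs F n =
    (\sum_(0 <= k < n.+1)
       num_partitions k * num_bijective_linear_graphs F (n - k))%N.
Proof.
split; last exact: num_linear_graphsE.
move=> S T Snil Tnil; split; first exact: nilpotent_jordan_form.
split; first exact: nilpotent_jordan_form.
move=> bS bT /(jordan_form_chain_basis Snil)[s sP <-].
move=> /(jordan_form_chain_basis Tnil)[t tP <-].
apply: iff_trans (chain_basis_dyn_equiv sP tP).
by apply: eq_dyn_equiv => v; rewrite /mxact mul_rV_lin1.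
Qed.
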